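(* Let $A_1,\dots,A_m$ be a weak $(n,m)$-AMD code in a finite abelian group $G$ of order $n$. Then the code is R-optimal if and only if the quantity $e_\delta$ takes the same value for all $\delta\in G^*$.
   Context: $G$ is a finite abelian group of order $n$, written additively, and $G^*=G\setminus\{0\}$. A weak $(n,m)$-AMD code is a collection of pairwise disjoint nonempty subsets $A_1,\dots,A_m$ of $G$; write $k_i=|A_i|$ and $T=\sum_{i=1}^m k_i$. For $\delta\in G^*$ and $1\le i\le m$ let $N_i(\delta)=|\{(a_i,a_j): a_i\in A_i,\ a_j\in A_j \text{ for some } j\neq i,\ a_i-a_j=\delta\}|$. Define $e_\delta=\frac1m\sum_{i=1}^m \frac{1}{k_i}N_i(\delta)$ (the probability that an adversary choosing $\delta$ succeeds when a source $i$ is chosen uniformly and then $g\in A_i$ uniformly, success meaning $g+\delta\in A_j$ for some $j\ne i$). The code is called R-optimal if $\max_{\delta\in G^*} e_\delta=\frac{(m-1)T}{m(n-1)}$ (this value is always a lower bound for $\max_{\delta\in G^*} e_\delta$, the ''R-bound''). *)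

(* Defs.v *)
From HB Require Import structures.
From mathcomp Require Import all_boot all_order all_algebra.

Set Implicit Arguments.
Unset Strict Implicit.
Unset Printing Implicit Defensive.

Import Order.TTheory GRing.Theory Num.Theory.
Local Open Scope ring_scope.

Section WeakAMD.
Variables (G : finZmodType) (n m : nat) (A : 'I_m -> {set G}).

Record weak_AMD_code : Prop := WeakAMDCode {
  AMD_order : #|G| = n;
  AMD_nonempty : forall i, A i != set0;
  AMD_disjoint : forall i j, i != j -> [disjoint A i & A j]
}.

Definition AMD_T : nat := (\sum_(i < m) #|A i|)%N.

Definition AMD_N (i : 'I_m) (delta : G) : nat :=
  #|[set p : G * G | [&& p.1 \in A i,
                         [exists j, (j != i) && (p.2 \in A j)] &
                         p.1 - p.2 == delta]]|.

Definition AMD_e (delta : G) : rat :=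
  m%:R^-1 * \sum_(i < m) (#|A i|%:R^-1 * (AMD_N i delta)%:R).

(* The values AMD_e are nonnegative, so the default value 0 does not affect
   the maximum when G has a nonzero element.  When n = 1 the maximum (over the
   empty set) and the bound (with denominator 0) are both 0. *)
Definition R_optimal : Prop :=
  \big[Num.max/0]_(delta : G | delta != 0) AMD_e delta
    = ((m%:R - 1) * AMD_T%:R) / (m%:R * (n%:R - 1)).

End WeakAMD.

(* Main.v *)
Require Import Defs.
From HB Require Import structures.
From mathcomp Require Import all_boot all_order all_algebra.

Set Implicit Arguments.
Unset Strict Implicit.
Unset Printing Implicit Defensive.

Import Order.TTheory GRing.Theory Num.Theory.
Local Open Scope ring_scope.

(** Summing N_i(δ) over all nonzero δ counts every pair of A_i × ⋃_{j≠i} A_j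
    once, because disjointness excludes δ = 0.  Hence the e_δ add up to
    (m-1)T/m whatever the code is, the R-bound is their average over G^*, and
    the maximum of finitely many numbers equals their average exactly when
    they all coincide. *)

(** If the maximum equals the mean, the nonnegative gaps between the maximum and the values sum to
    zero, so each gap vanishes. *)
Lemma bigmax_eq_mean (R : realFieldType) (I : finType) (P : pred I)
    (F : I -> R) :
  (forall i, P i -> 0 <= F i) ->
  \big[Num.max/0]_(i | P i) F i = (\sum_(i | P i) F i) / #|P|%:R <->
  (forall i j, P i -> P j -> F i = F j).
Proof.
move=> F_ge0; set M := \big[_/_]_(_ | _) _.
have F_le i : P i -> F i <= M by move=> Pi; apply: le_bigmax_cond.
(* For empty [P] both sides are 0: the default of the maximum, and an empty sum times the inverse of
   0. *)
have [i0 Pi0 | P0] := pickP P; last first.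
  split=> [_ i j Pi | _]; first by rewrite P0 in Pi.
  by rewrite /M !big_pred0 // mul0r.
have cardP_neq0 : #|P|%:R != 0 :> R.
  by rewrite pnatr_eq0 -lt0n; apply/card_gt0P; exists i0.
split=> [M_mean i j Pi Pj | F_const].
  have gap0 : \sum_(k | P k) (M - F k) = 0.
    by rewrite sumrB sumr_const -mulr_natr M_mean divfK // subrr.
  have gapE k : P k -> F k = M.
    move=> Pk; apply/esym/eqP; rewrite -subr_eq0; apply/eqP.
    by apply: (psumr_eq0P _ gap0) => // l Pl; rewrite subr_ge0 F_le.
  by rewrite !gapE.
have -> : \sum_(i | P i) F i = F i0 *+ #|P|.
  by rewrite -sumr_const; apply: eq_bigr => i Pi; apply: F_const.
rewrite -[F i0 *+ _]mulr_natr mulfK //; apply/le_anti; rewrite F_le // andbT.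
(* Bounding the maximum by [F i0] also requires the default 0 to be at most [F i0], hence
   [F_ge0]. *)
by apply/bigmax_leP; split=> [|i Pi]; rewrite ?F_ge0 // (F_const i i0).
Qed.

Section CodeSums.
Variables (G : finZmodType) (n m : nat) (A : 'I_m -> {set G}).
Hypothesis hA : weak_AMD_code n A.

(** By disjointness, the other blocks fill exactly the complement of [A i] in the union of all
    blocks. *)
Lemma card_others (i : 'I_m) :
  (#|A i| + #|[set b | [exists j, (j != i) && (b \in A j)]]| = AMD_T A)%N.
Proof.
have [_ _ A_disj] := hA.
set B := [set b | _].
have -> : AMD_T A = #|\bigcup_j A j|.
  rewrite -sum1_card partition_disjoint_bigcup //.
  by apply: eq_bigr => j _; rewrite sum1_card.
rewrite -cardsUI; have -> : A i :&: B = set0.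
  apply/setP=> x; rewrite !inE; apply/negP=> /andP[xi /existsP[j /andP[ji xj]]].
  by move: (A_disj _ _ ji) => /pred0P/(_ x)/=; rewrite xi xj.
rewrite cards0 addn0; congr #|pred_of_set _|.
apply/setP=> x; rewrite !inE; apply/orP/bigcupP.
  by case=> [xi|/existsP[j /andP[_ xj]]]; [exists i|exists j].
case=> j _ xj; have [ji|ji] := eqVneq j i; first by left; rewrite -ji.
by right; apply/existsP; exists j; rewrite ji.
Qed.

Lemma sum_AMD_N (i : 'I_m) :
  (\sum_(delta | delta != 0%R) AMD_N A i delta
     = #|A i| * (AMD_T A - #|A i|))%N.
Proof.
have [_ _ A_disj] := hA.
rewrite -(card_others i) addKn -cardsX.
(* The pairs are sorted by their difference; the fibre over [delta] is the set counted by
   [AMD_N]. *)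
rewrite -sum1_card (partition_big (fun p : G * G => p.1 - p.2)
  (fun delta => delta != 0)) /=.
  apply: eq_bigr => delta _; rewrite /AMD_N -sum1_card.
  by apply: eq_bigl => -[a b]; rewrite !inE andbA.
case=> a b; rewrite !inE /= => /andP[ai /existsP[j /andP[ji bj]]].
(* A zero difference would put one element in both [A i] and [A j]. *)
rewrite subr_eq0; apply: contraTneq ai => ->.
by rewrite (disjointFr (A_disj _ _ ji) bj).
Qed.

Lemma sum_AMD_e :
  \sum_(delta | delta != 0) AMD_e A delta
    = m%:R^-1 * ((m%:R - 1) * (AMD_T A)%:R).
Proof.
have [_ A_neq0 _] := hA.
rewrite -mulr_sumr exchange_big /=; congr (_ * _).
(* The weight of block [i] cancels the factor [#|A i|], nonzero because the block is nonempty. *)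
transitivity (\sum_(i < m) ((AMD_T A)%:R - #|A i|%:R : rat)).
  apply: eq_bigr => i _; rewrite -mulr_sumr -natr_sum sum_AMD_N natrM mulKf.
    by rewrite natrB // -(card_others i) leq_addr.
  by rewrite pnatr_eq0 cards_eq0.
by rewrite sumrB sumr_const card_ord -natr_sum mulrBl mul1r mulr_natl.
Qed.

Lemma card_nonzero : #|[pred delta : G | delta != 0]|%:R = n%:R - 1 :> rat.
Proof.
have [<- _ _] := hA.
by rewrite (cardC1 (0 : G)) -subn1 natrB //; apply/card_gt0P; exists 0.
Qed.

End CodeSums.

Theorem mainTheorem1 (G : finZmodType) (n m : nat) (A : 'I_m -> {set G})
    (hA : weak_AMD_code n A) :
  R_optimal n A <->
  (forall delta delta' : G, delta != 0 -> delta' != 0 ->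
     AMD_e A delta = AMD_e A delta').
Proof.
have e_ge0 (delta : G) : delta != 0 -> 0 <= AMD_e A delta.
  move=> _; rewrite /AMD_e mulr_ge0 ?invr_ge0 ?ler0n // sumr_ge0 // => i _.
  by rewrite mulr_ge0 ?invr_ge0 ?ler0n.
have := bigmax_eq_mean e_ge0.
rewrite (sum_AMD_e hA) (card_nonzero hA) /R_optimal.
(* [invfM] holds for zero factors too, so [n = 1] needs no separate case. *)
by rewrite [m%:R^-1 * _]mulrC -(mulrA _ m%:R^-1) -invfM.
Qed.
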